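(* Let $n\ge1$. If $b\in\Delta_n\setminus\{e_n\}$, then $$|C_{+}(b)|=|C_{-}(b)|=4^{n-1}.$$
   Context: $\Delta_n=\{1,2,4,7\}^n$ is the set of words of length $n$, and $e_n=77\cdots7$. Digits are identified with quaternionic symbols: $1=i$, $2=j$, $4=k$, $7=e$, where $e$ is the identity, $i^2=j^2=k^2=-e$, $ij=k=-ji$, $jk=i=-kj$, $ki=j=-ik$. Words are multiplied coordinate by coordinate, with the local quaternionic signs collected into one global sign, so that products lie in $\Delta_n\sqcup(-\Delta_n)$. For $b\in\Delta_n$, $C_{+}(b)=\{c\in\Delta_n:cb=bc\text{ and }cb\in\Delta_n\}$ and $C_{-}(b)=\{c\in\Delta_n:cb=bc\text{ and }cb\in-\Delta_n\}$. *)

(* Defs.v *)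
From HB Require Import structures.
From mathcomp Require Import all_boot.

Set Implicit Arguments.
Unset Strict Implicit.
Unset Printing Implicit Defensive.

(* Quaternionic reading of the digits: 1 = i, 2 = j, 4 = k, 7 = e. *)
Inductive digit : Type := D1 | D2 | D4 | D7.

Definition nat_of_digit (d : digit) : nat :=
  match d with D1 => 1 | D2 => 2 | D4 => 4 | D7 => 7 end.

Definition digit_of_nat (m : nat) : option digit :=
  match m with
  | 1 => Some D1 | 2 => Some D2 | 4 => Some D4 | 7 => Some D7 | _ => None
  end.

Lemma nat_of_digitK : pcancel nat_of_digit digit_of_nat.
Proof. by case. Qed.

HB.instance Definition _ := Countable.copy digit (pcan_type nat_of_digitK).

Lemma digit_enumP : Finite.axiom [:: D1; D2; D4; D7].
Proof. by case. Qed.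

HB.instance Definition _ := isFinite.Build digit digit_enumP.

Notation Delta n := (n.-tuple digit).

(* A signed object is a pair (s, x) standing for (-1)^s x: the sign bit is
   [true] for negative. Thus [signed (Delta n)] is the disjoint union of
   Delta_n and -Delta_n. *)
Notation signed T := (bool * T)%type.

Definition dmul (c d : digit) : signed digit :=
  match c, d with
  | D7, _ => (false, d)
  | _, D7 => (false, c)
  | D1, D1 | D2, D2 | D4, D4 => (true, D7)
  | D1, D2 => (false, D4)
  | D2, D1 => (true, D4)
  | D2, D4 => (false, D1)
  | D4, D2 => (true, D1)
  | D4, D1 => (false, D2)
  | D1, D4 => (true, D2)
  end.

Definition wmul (n : nat) (c b : Delta n) : signed (Delta n) :=
  (\big[addb/false]_(i < n) (dmul (tnth c i) (tnth b i)).1,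
   [tuple (dmul (tnth c i) (tnth b i)).2 | i < n]).

Definition eword (n : nat) : Delta n := [tuple of nseq n D7].

Definition in_Delta (n : nat) (x : signed (Delta n)) : bool := ~~ x.1.
Definition in_negDelta (n : nat) (x : signed (Delta n)) : bool := x.1.

Definition Cplus (n : nat) (b : Delta n) : {set Delta n} :=
  [set c | (wmul c b == wmul b c) && in_Delta (wmul c b)].

Definition Cminus (n : nat) (b : Delta n) : {set Delta n} :=
  [set c | (wmul c b == wmul b c) && in_negDelta (wmul c b)].

(* Main.v *)
Require Import Defs.
From mathcomp Require Import all_boot.

Set Implicit Arguments.
Unset Strict Implicit.
Unset Printing Implicit Defensive.

(** For a fixed [b], the class of [c] is decided by the pair of signs of [cb] and
    [bc].  At a coordinate where [b] is not the identity, the four digits realise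
    the four possible pairs of signs exactly once each; hence changing that single
    coordinate of [c] shifts the global pair of signs by any prescribed element of
    (Z/2)^2, so all four pairs are attained equally often among the [4 ^ n] words. *)

Definition dsigns (b d : digit) : bool * bool := ((dmul d b).1, (dmul b d).1).

Definition wsigns (n : nat) (b c : Delta n) : bool * bool :=
  ((wmul c b).1, (wmul b c).1).

Definition addbb (p q : bool * bool) : bool * bool := (p.1 (+) q.1, p.2 (+) q.2).

Definition replace (n : nat) (c : Delta n) (i : 'I_n) (d : digit) : Delta n :=
  [tuple if j == i then d else tnth c j | j < n].

Lemma card_digit : #|{: digit}| = 4.
Proof. by rewrite cardE enumT unlock. Qed.

Lemma dmul_abs_comm (c d : digit) : (dmul c d).2 = (dmul d c).2.
Proof. by case: c; case: d. Qed.

(** Up to sign the digits form the Klein four-group, which is abelian, so only the global signs can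
    differ. *)
Lemma wmul_commE (n : nat) (b c : Delta n) :
  (wmul c b == wmul b c) = ((wmul c b).1 == (wmul b c).1).
Proof.
rewrite -pair_eqE /pair_eq /=; apply/andb_idr => _; apply/eqP/eq_from_tnth => i.
by rewrite !tnth_mktuple dmul_abs_comm.
Qed.

(** The identity gives two plus signs, [b] itself two minus signs, and the other two digits
    anticommute with [b], with opposite orders of signs. *)
Lemma dsigns_bij (b : digit) : b != D7 -> bijective (dsigns b).
Proof.
move=> bN7; apply: inj_card_bij; last by rewrite card_prod card_bool card_digit.
by case: b bN7 => // _ [] [].
Qed.

Lemma neq_ewordP (n : nat) (b : Delta n) :
  b != eword n -> exists i, tnth b i != D7.
Proof.
move=> bNe; apply/existsP; apply: contraNT bNe; rewrite negb_exists => /forallP b7.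
apply/eqP/eq_from_tnth => i; rewrite (tnth_nth D7 (eword n)) nth_nseq ltn_ord.
by have /negPn/eqP := b7 i.
Qed.

(** All coordinates but [i] contribute equally to both words; each side adds the contribution at [i]
    that the other word carries. *)
Lemma wsigns_replace (n : nat) (b c : Delta n) (i : 'I_n) (d : digit) :
  addbb (wsigns b (replace c i d)) (dsigns (tnth b i) (tnth c i))
  = addbb (wsigns b c) (dsigns (tnth b i) d).
Proof.
have replaceN j : j != i -> tnth (replace c i d) j = tnth c j.
  by rewrite tnth_mktuple => /negbTE->.
have replace_i : tnth (replace c i d) i = d by rewrite tnth_mktuple eqxx.
rewrite /addbb /wsigns /=; congr pair.
- rewrite (bigD1 i) //= [in RHS](bigD1 i) //= replace_i.
  under eq_bigr => j /replaceN -> do [].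
  by rewrite -!addbA addbC -addbA addbCA; congr addb; rewrite addbC.
- rewrite (bigD1 i) //= [in RHS](bigD1 i) //= replace_i.
  under eq_bigr => j /replaceN -> do [].
  by rewrite -!addbA addbC -addbA addbCA; congr addb; rewrite addbC.
Qed.

(** An involution of the words sends class [p] into class [q]; exchanging [p] and [q] later yields
    equality. *)
Lemma leq_card_wsigns (n : nat) (b : Delta n) (p q : bool * bool) :
  b != eword n ->
  #|[set c | wsigns b c == p]| <= #|[set c | wsigns b c == q]|.
Proof.
move=> /neq_ewordP[i /dsigns_bij[g gK Kg]].
(* [sh d] is the digit whose signs against the [i]-th digit of [b] differ from those of [d] by
   [p + q], the shift taking [p] to [q]. *)
pose sh d := g (addbb (dsigns (tnth b i) d) (addbb p q)).
have shK : involutive sh.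
  move=> d; rewrite /sh Kg -[RHS]gK; congr g; case: (dsigns _ d) => x y.
  by rewrite /addbb /= !addbK.
pose f c := replace c i (sh (tnth c i)).
have fK : involutive f.
  move=> c; apply: eq_from_tnth => j; rewrite /f !tnth_mktuple eqxx shK.
  by case: eqP => [->|].
rewrite -(card_imset _ (inv_inj fK)); apply/subset_leq_card/subsetP => x /imsetP[c].
rewrite !inE => /eqP cp -> {x}.
have := wsigns_replace b c i (sh (tnth c i)).
rewrite -/(f c) cp /sh Kg /addbb; case: (wsigns b (f c)) => x y.
case: (dsigns _ _) => u v; case: (p) => p1 p2; case: (q) => q1 q2 /=.
by case: p1 p2 q1 q2 x y u v => [] [] [] [] [] [] [] [].
Qed.

Lemma card_wsigns (n : nat) (b : Delta n) (p : bool * bool) :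
  0 < n -> b != eword n -> #|[set c | wsigns b c == p]| = 4 ^ (n - 1).
Proof.
(* Multiplying by 4 turns the claim into a count of all [4 ^ n] words, split into four classes of
   equal size. *)
move=> n_gt0 bNe; apply/eqP; rewrite -(eqn_pmul2l (isT : 0 < 4)) -expnS subn1 prednK //.
rewrite -card_digit -card_tuple -[X in _ == X]sum1_card.
rewrite (partition_big (wsigns b) predT) //=.
rewrite (eq_bigr (fun=> #|[set c | wsigns b c == p]|)) => [|q _].
  by rewrite sum_nat_const card_prod card_bool card_digit.
rewrite sum1dep_card; apply/eqP.
by rewrite eqn_leq !leq_card_wsigns.
Qed.

Theorem corollary6p10 (n : nat) (hn : 1 <= n) (b : Delta n)
    (hb : b != eword n) :
  #|Cplus b| = #|Cminus b| /\ #|Cminus b| = 4 ^ (n - 1).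
Proof.
(* Commuting makes the two signs equal, so the sign of [cb] determines the pair. *)
have -> : Cplus b = [set c | wsigns b c == (false, false)].
  apply/setP => c; rewrite !inE wmul_commE /in_Delta /wsigns -pair_eqE /pair_eq.
  by case: (_.1) (_.1) => [] [].
have -> : Cminus b = [set c | wsigns b c == (true, true)].
  apply/setP => c; rewrite !inE wmul_commE /in_negDelta /wsigns -pair_eqE /pair_eq.
  by case: (_.1) (_.1) => [] [].
by rewrite !card_wsigns.
Qed.
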